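(* Let $\mathcal{H}$ be a real Hilbert space, let $A:\mathcal{H}\to 2^{\mathcal{H}}$ be maximally monotone, let $\alpha,\beta\in(0,+\infty)$, and let $B:\mathcal{H}\to\mathcal{H}$ be a monotone and $\beta$-Lipschitzian operator such that $\operatorname{zer}(A+B)\neq\emptyset$. Let $(\eta_n)_{n\in\mathbb{N}}\in\ell^1_+(\mathbb{N})$ and let $(U_n)_{n\in\mathbb{N}}$ be a sequence in $\mathcal{P}_\alpha(\mathcal{H})$ such that $$\mu=\sup_{n\in\mathbb{N}}\|U_n\|<+\infty\quad\text{and}\quad(\forall n\in\mathbb{N})\quad(1+\eta_n)U_{n+1}\succcurlyeq U_n.$$ Let $\lambda<\frac{1}{\sqrt{10}\,\mu\beta}$ and let $(\gamma_n)_{n\in\mathbb{N}}$ be a sequence in $(0,\lambda]$ with $\liminf_{n\to+\infty}\gamma_n>0$. Let $(a_n)_{n\in\mathbb{N}}$, $(b_n)_{n\in\mathbb{N}}$ and $(c_n)_{n\in\mathbb{N}}$ be absolutely summable sequences in $\mathcal{H}$. Let $x_0,p_{-1}\in\mathcal{H}$ and set, for every $n\in\mathbb{N}$, $$\begin{cases} y_n=x_n-\gamma_nU_n\big(B(p_{n-1})+a_n\big),\\ p_n=J_{\gamma_nU_nA}(y_n)+b_n,\\ q_n=p_n-\gamma_nU_n\big(B(p_n)+c_n\big),\\ x_{n+1}=x_n-y_n+q_n.\end{cases}$$ Then the following hold for some $\bar{x}\in\operatorname{zer}(A+B)$: (i) $\sum_{n\in\mathbb{N}}\|x_n-p_n\|^2<+\infty$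 and $\sum_{n\in\mathbb{N}}\|y_n-q_n\|^2<+\infty$; (ii) $x_n\rightharpoonup\bar{x}$ and $p_n\rightharpoonup\bar{x}$.
   Context: $\mathbb{N}=\{0,1,2,\dots\}$. $\langle\cdot,\cdot\rangle$ and $\|\cdot\|$ denote the scalar product and norm of $\mathcal{H}$ (and $\|\cdot\|$ also the operator norm); $\rightharpoonup$ denotes weak convergence; $Id$ is the identity operator. $\ell^1_+(\mathbb{N})$ is the set of summable sequences in $[0,+\infty)$; a sequence $(a_n)$ in $\mathcal{H}$ is absolutely summable if $\sum_n\|a_n\|<+\infty$. For self-adjoint bounded linear operators $U,V$ on $\mathcal{H}$, $U\succcurlyeq V$ means $\langle Ux,x\rangle\ge\langle Vx,x\rangle$ for all $x\in\mathcal{H}$, and $\mathcal{P}_\alpha(\mathcal{H})$ is the set of self-adjoint bounded linear operators $U$ on $\mathcal{H}$ with $U\succcurlyeq\alpha\, Id$. A set-valued operator $A:\mathcal{H}\to2^{\mathcal{H}}$ has graph $\{(x,u): u\in Ax\}$ and zero set $\operatorname{zer}A=\{x: 0\in Ax\}$; it is monotone if $\langle x-y,u-v\rangle\ge0$ for all $(x,u),(y,v)$ in its graph, and maximally monotone if it is monotone and no monotone operator has a graph properly containing its graph. The resolvent of $A$ is $J_A=(Id+A)^{-1}$. An operator $B:\mathcal{H}\to\mathcal{H}$ is $\beta$-Lipschitzian if $\|Bx-By\|\le\beta\|x-y\|$ for all $x,y\in\mathcal{H}$. Here $\gamma_nU_nA$ is the operator $x\mapsto\{\gamma_nU_nu: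 u\in Ax\}$; for $A$ maximally monotone, $U_n\in\mathcal{P}_\alpha(\mathcal{H})$ and $\gamma_n>0$, the resolvent $J_{\gamma_nU_nA}$ is single-valued and defined on all of $\mathcal{H}$. *)

(* Defs.v *)
From HB Require Import structures.
From mathcomp Require Import all_boot all_order all_algebra.
From mathcomp Require Import all_classical all_reals all_analysis.

Set Implicit Arguments.
Unset Strict Implicit.
Unset Printing Implicit Defensive.

Import Order.TTheory GRing.Theory Num.Theory numFieldNormedType.Exports.

Local Open Scope classical_set_scope.
Local Open Scope ring_scope.

(* A real Hilbert space is a complete normed module H over R : realType with a
   dot product ip : {dot H for idfun} such that `|x| ^+ 2 = ip x x for all x. *)

Definition gra (T : Type) (A : T -> set T) : set (T * T) :=
  [set xu | A xu.1 xu.2].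

Definition single_valued (T : Type) (B : T -> T) : T -> set T :=
  fun x => [set B x].

Definition op_inv (T : Type) (A : T -> set T) : T -> set T :=
  fun u => [set x | A x u].

Definition op_add (V : zmodType) (A B : V -> set V) : V -> set V :=
  fun x => [set u + v | u in A x & v in B x].

Definition op_image (T : Type) (f : T -> T) (A : T -> set T) : T -> set T :=
  fun x => f @` A x.

Definition zer (V : zmodType) (A : V -> set V) : set V := [set x | A x 0].

(* (Id + A)^-1 as a set-valued operator. *)
Definition resolvent (V : zmodType) (A : V -> set V) : V -> set V :=
  op_inv (op_add (single_valued idfun) A).

Definition monotone_op (R : realType) (H : completeNormedModType R)
    (ip : {dot H for idfun}) (A : H -> set H) : Prop :=
  forall x u y v : H,
    gra A (x, u) -> gra A (y, v) -> 0 <= ip (x - y) (u - v).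

Definition maximally_monotone_op (R : realType) (H : completeNormedModType R)
    (ip : {dot H for idfun}) (A : H -> set H) : Prop :=
  monotone_op ip A /\
  ~ exists A' : H -> set H, monotone_op ip A' /\ gra A `<` gra A'.

Definition bounded_linear (R : realType) (H : completeNormedModType R)
    (U : {linear H -> H}) : Prop :=
  exists M : R, forall x : H, `|U x| <= M * `|x|.

Definition op_norm (R : realType) (H : completeNormedModType R)
    (U : {linear H -> H}) : \bar R :=
  ereal_sup [set (`|U x|)%:E | x in [set x : H | `|x| <= 1]].

Definition self_adjoint (R : realType) (H : completeNormedModType R)
    (ip : {dot H for idfun}) (U : H -> H) : Prop :=
  forall x y : H, ip (U x) y = ip x (U y).

Definition loewner_ge (R : realType) (H : completeNormedModType R)
    (ip : {dot H for idfun}) (U V : H -> H) : Prop :=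
  forall x : H, ip (U x) x >= ip (V x) x.

Definition P_ (R : realType) (H : completeNormedModType R)
    (ip : {dot H for idfun}) (alpha : R) : set {linear H -> H} :=
  [set U | [/\ bounded_linear U, self_adjoint ip U &
               loewner_ge ip U (fun x => alpha *: x)]].

Definition weak_cvg (R : realType) (H : completeNormedModType R)
    (ip : {dot H for idfun}) (x : nat -> H) (l : H) : Prop :=
  forall z : H, (fun n => ip (x n) z) @ \oo --> ip l z.

Definition summable_seq (R : realType) (u : nat -> R) : Prop :=
  cvgn (series u).

Definition abs_summable (R : realType) (H : completeNormedModType R)
    (a : nat -> H) : Prop :=
  cvgn [normed series a].

Definition ell1_plus (R : realType) : set (nat -> R) :=
  [set u | (forall n, 0 <= u n) /\ summable_seq u].

(* n |-> p (n - 1), where pm1 is the term of index -1. *)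
Definition prev_term (T : Type) (pm1 : T) (p : nat -> T) (n : nat) : T :=
  if n is m.+1 then p m else pm1.

(* Main.v *)
Require Import Defs.
From HB Require Import structures.
From mathcomp Require Import all_boot all_order all_algebra.
From mathcomp Require Import all_classical all_reals all_analysis.
From mathcomp Require Import ring lra.

Set Implicit Arguments.
Unset Strict Implicit.
Unset Printing Implicit Defensive.

Import Order.TTheory GRing.Theory Num.Theory numFieldNormedType.Exports.

Local Open Scope classical_set_scope.
Local Open Scope ring_scope.

(* Writing s_n = p_n - b_n for the exact resolvent values, all the errors merge
   into two absolutely summable sequences g and f with, for some w_n in A s_n,
     x_n - s_n = gamma_n U_n (w_n + B s_{n-1} + g_n),
     x_{n+1} = x_n - gamma_n U_n (w_n + B s_n) + f_n.
   For z in zer(A+B), monotonicity and the Lipschitz bound show that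
     V_n = <U_n^-1 (x_n - z), x_n - z> + |x_n - s_{n-1}|^2 / (2 mu)
   decreases by at least a multiple of |x_n - s_n|^2 + |x_n - s_{n-1}|^2, up to
   summable perturbations.  Weak convergence then follows from an Opial argument
   in which subsequences are replaced by ultrafilters on nat: along an
   ultrafilter every bounded sequence has a weak limit, by the Riesz theorem. *)

(** * Summable real sequences and perturbed monotone recursions *)

Section real_sequences.
Context {R : realType}.
Implicit Types u v chi : nat -> R.

Lemma summable_le u v :
  (forall n, 0 <= u n <= v n) -> summable_seq v -> summable_seq u.
Proof.
move=> uv; apply: series_le_cvg => n; have /andP[u0 le_uv] := uv n => //.
exact: le_trans le_uv.
Qed.

Lemma summableD u v :
  summable_seq u -> summable_seq v -> summable_seq (fun n => u n + v n).
Proof. by move=> su sv; apply: is_cvg_seriesD. Qed.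

Lemma summableZ (k : R) u :
  summable_seq u -> summable_seq (fun n => k * u n).
Proof. by move=> su; apply: is_cvg_seriesZ. Qed.

Lemma summable_shift u : summable_seq u -> summable_seq (fun n => u n.+1).
Proof.
move=> su; rewrite /summable_seq.
rewrite (_ : series _ = (fun n => series u n.+1 - u 0%N)); last first.
  by apply/funext => n; rewrite /series /= big_nat_recl // addrC addKr.
apply: is_cvgB; last exact: is_cvg_cst.
by apply/cvg_ex; have /cvg_ex[l ul] := su; exists l; rewrite cvg_shiftS.
Qed.

Lemma cauchy_cvgn (V : completeNormedModType R) (u : nat -> V) :
  (forall e : R, 0 < e -> exists N, forall n, (N <= n)%N -> `|u N - u n| < e) ->
  cvgn u.
Proof.
move=> uC; apply/cauchy_cvgP/cauchy_exP => e /uC[N NP].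
exists (u N); apply: filterS (nbhs_infty_ge N) => n /NP.
by rewrite -ball_normE.
Qed.

Lemma cvgn_bounded (V : normedModType R) (u : nat -> V) :
  cvgn u -> exists2 C, 0 < C & forall n, `|u n| <= C.
Proof.
move=> /cvg_seq_bounded [M [Mr Mb]].
exists (`|M| + 1) => [|n]; first by rewrite ltr_wpDl.
by apply: Mb => //; rewrite (le_lt_trans (ler_norm M)) // ltrDl.
Qed.

Lemma summable_bounded u :
  summable_seq u -> exists2 C, 0 < C & forall n, `|u n| <= C.
Proof.
by move=> /cvg_series_cvg_0 u0; apply: cvgn_bounded; apply/cvg_ex; exists 0.
Qed.

Lemma summable_bounded_sum u : (forall n, 0 <= u n) -> summable_seq u ->
  exists2 C, 0 <= C & forall n, series u n <= C.
Proof.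
move=> u0 su; exists (limn (series u)) => [|n].
  by apply: limr_ge => //; apply: nearW => n; apply: sumr_ge0 => i _; exact: u0.
apply: nondecreasing_cvgn_le => //.
by apply/nondecreasing_seqP => k; rewrite seriesSr lerDl.
Qed.

Lemma summable_sqr u : (forall n, 0 <= u n) -> summable_seq u ->
  summable_seq (fun n => u n ^+ 2).
Proof.
move=> u0 su; have [C C0 uC] := summable_bounded su.
apply: (@summable_le _ (fun n => C * u n)); last exact: summableZ.
move=> n; rewrite sqr_ge0 expr2 ler_wpM2r //.
by apply: le_trans (uC n); exact: ler_norm.
Qed.

(** The factor accumulated by [n] steps of [V n.+1 <= (1 + chi n) * V n]. *)
Definition growth chi n : R := \prod_(k < n) (1 + chi k).

Lemma growthS chi n : growth chi n.+1 = growth chi n * (1 + chi n).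
Proof. by rewrite /growth big_ord_recr. Qed.

Lemma growth_ge1 chi n : (forall k, 0 <= chi k) -> 1 <= growth chi n.
Proof.
move=> chi0; elim: n => [|n IH]; first by rewrite /growth big_ord0.
by rewrite growthS (le_trans IH) // ler_peMr ?(le_trans _ IH) // lerDl.
Qed.

(** The products increase, and [1 + t <= expR t] bounds them by the exponential of a bound on the
    partial sums. *)
Lemma growth_cvg chi : (forall k, 0 <= chi k) -> summable_seq chi ->
  cvgn (growth chi).
Proof.
move=> chi0 schi; have [C C0 HC] := summable_bounded_sum chi0 schi.
apply: nondecreasing_is_cvgn.
  apply/nondecreasing_seqP => n; rewrite growthS ler_peMr ?lerDl //.
  exact: le_trans ler01 (growth_ge1 _ chi0).
exists (expR C) => _ [n _ <-]; apply: (@le_trans _ _ (expR (series chi n))).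
  elim: n => [|n IH].
    by rewrite /growth big_ord0 /series /= big_nil expR0.
  rewrite growthS seriesSr expRD ler_pM // ?expR_ge1Dx ?addr_ge0 //.
  exact: le_trans ler01 (growth_ge1 _ chi0).
by rewrite ler_expR.
Qed.

(* Robbins--Siegmund without randomness: dividing by the growth factor turns
   [V - (partial sums of errors)] into a nonincreasing sequence. *)
Lemma robbins_siegmund (V chi delta E : nat -> R) :
  (forall n, 0 <= V n) -> (forall n, 0 <= chi n) ->
  (forall n, 0 <= delta n) -> (forall n, 0 <= E n) ->
  summable_seq chi -> summable_seq E ->
  (forall n, V n.+1 <= (1 + chi n) * (V n - delta n + E n)) ->
  cvgn V /\ summable_seq delta.
Proof.
move=> V0 chi0 d0 E0 schi sE step.
pose g := growth chi.
have g1 n : 1 <= g n by exact: growth_ge1.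
have g0 n : 0 < g n by exact: lt_le_trans ltr01 (g1 n).
have gcvg : cvgn g by exact: growth_cvg.
have chi1 n : 0 < 1 + chi n by rewrite ltr_pwDl.
pose d' n := delta n / g n; pose E' n := E n / g n.
have d'0 n : 0 <= d' n by rewrite divr_ge0 // ltW.
have E'0 n : 0 <= E' n by rewrite divr_ge0 // ltW.
have sE' : summable_seq E'.
  apply: (@summable_le _ E) => // n.
  by rewrite E'0 ler_pdivrMr // ler_peMr.
have [C C0 HC] := summable_bounded_sum E'0 sE'.
have step' n : V n.+1 / g n.+1 <= V n / g n - d' n + E' n.
  rewrite ler_pdivrMr // (le_trans (step n)) // /g growthS -/(g n).
  rewrite le_eqVlt (_ : _ == _ = true) //; apply/eqP; rewrite /d' /E'.
  by have := lt0r_neq0 (g0 n); move=> ?; field.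
pose S n := V n / g n + series d' n - series E' n.
have Scvg : cvgn S.
  apply: nonincreasing_is_cvgn.
    apply/nonincreasing_seqP => n; rewrite /S !seriesSr.
    by have := step' n; lra.
  exists (- C) => _ [n _ <-]; rewrite /S.
  have : 0 <= V n / g n by rewrite divr_ge0 // ltW.
  have : 0 <= series d' n by apply: sumr_ge0 => i _; exact: d'0.
  by have := HC n; lra.
(* Since [S] decreases and [V n / g n] is nonnegative, the partial sums of [d'] are at most
   [S 0 + C]. *)
have sd' : summable_seq d'.
  apply: nondecreasing_is_cvgn.
    by apply/nondecreasing_seqP => n; rewrite seriesSr lerDl.
  exists (S 0%N + C) => _ [n _ <-].
  have : S n <= S 0%N.
    elim: n => // n IH; apply: le_trans IH; rewrite /S !seriesSr.
    by have := step' n; lra.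
  rewrite {1}/S; have : 0 <= V n / g n by rewrite divr_ge0 // ltW.
  by have := HC n; lra.
split.
  rewrite (_ : V = (fun n => (S n - series d' n + series E' n) * g n)).
    by apply: is_cvgM => //; apply: is_cvgD => //; apply: is_cvgB.
  apply/funext => n; rewrite /S.
  by have := lt0r_neq0 (g0 n); move=> h; field.
(* As [g] is bounded, the division by it cost only a constant: [delta n <= G * d' n]. *)
have [G G0 gG] : exists2 G, 0 < G & forall n, g n <= G.
  have [G G0 gG] := cvgn_bounded gcvg.
  by exists G => // n; apply: le_trans (gG n); exact: ler_norm.
apply: (@summable_le _ (fun n => G * d' n)); last exact: summableZ.
move=> n; rewrite d0 /=.
have -> : delta n = g n * d' n.
  by rewrite /d' mulrC divfK //; exact: lt0r_neq0.
by rewrite ler_wpM2r.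
Qed.

(** Compactness of [[- C, C]] gives a cluster point of the image filter, and an ultrafilter
    converges to each of its cluster points. *)
Lemma ultra_bounded_cvg (F : set_system nat) (u : nat -> R) (C : R) :
  UltraFilter F -> (forall n, `|u n| <= C) ->
  exists l : R, u n @[n --> F] --> l.
Proof.
move=> FU uC.
pose G := u @ F; have GF : ProperFilter G by exact: fmap_proper_filter.
have /(segment_compact GF) [l [_ lcl]] : G `[- C, C]%classic.
  by apply: (@filterE _ F) => n; rewrite /= in_itv /= -ler_norml.
exists l => A lA; case: (in_ultra_setVsetC (u @^-1` A) FU) => // FA.
by have [y [yA]] := lcl (~` A) A FA lA.
Qed.

End real_sequences.

(** * Inner product calculus, weak limits along filters, Riesz representation *)

Section hilbert.
Context {R : realType} {H : completeNormedModType R} (ip : {dot H for idfun}).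
Context (ip_norm : forall x : H, `|x| ^+ 2 = ip x x).
Implicit Types u v w z : H.

Lemma ipC u v : ip u v = ip v u.
Proof. by rewrite hermC expr0 mul1r. Qed.

Lemma ipZl (k : R) u v : ip (k *: u) v = k * ip u v.
Proof. exact: linearZl_LR. Qed.

Lemma ipZr (k : R) u v : ip u (k *: v) = k * ip u v.
Proof. by rewrite ipC ipZl ipC. Qed.

Lemma ipDl u v w : ip (u + v) w = ip u w + ip v w.
Proof. exact: linearDl. Qed.

Lemma ipDr u v w : ip w (u + v) = ip w u + ip w v.
Proof. exact: linearDr. Qed.

Lemma ipNl u v : ip (- u) v = - ip u v.
Proof. exact: linearNl. Qed.

Lemma ipNr u v : ip u (- v) = - ip u v.
Proof. exact: linearNr. Qed.

Lemma ip0l u : ip 0 u = 0.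
Proof. exact: linear0l. Qed.

Lemma ip0r u : ip u 0 = 0.
Proof. exact: linear0r. Qed.

Definition ipE := (ipDl, ipDr, ipNl, ipNr, ip0l, ip0r, ipZl, ipZr).

(* [linearB] and [linearZ] would also rewrite with the linearity of [ip]. *)
Lemma opB (U : {linear H -> H}) u v : U (u - v) = U u - U v.
Proof. exact: linearB. Qed.

Lemma opD (U : {linear H -> H}) u v : U (u + v) = U u + U v.
Proof. exact: linearD. Qed.

Lemma opZ (U : {linear H -> H}) (k : R) u : U (k *: u) = k *: U u.
Proof. exact: linearZ_LR. Qed.

Lemma normB_sqr u v : `|u - v| ^+ 2 = `|u| ^+ 2 - 2 * ip u v + `|v| ^+ 2.
Proof. rewrite !ip_norm !ipE.  by rewrite (ipC v u); ring. Qed.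

Lemma normD_sqr u v : `|u + v| ^+ 2 = `|u| ^+ 2 + 2 * ip u v + `|v| ^+ 2.
Proof. rewrite !ip_norm !ipE.  by rewrite (ipC v u); ring. Qed.

Lemma normD_sqr_le u v : `|u + v| ^+ 2 <= 2 * (`|u| ^+ 2 + `|v| ^+ 2).
Proof. by have := sqr_ge0 `|u - v|; rewrite normD_sqr normB_sqr; lra. Qed.

Lemma normB_sqr_le u v : `|u - v| ^+ 2 <= 2 * (`|u| ^+ 2 + `|v| ^+ 2).
Proof. by rewrite -[`|v|]normrN normD_sqr_le. Qed.

(** Expand the squared norm of [u] minus its projection onto the line of [v]. *)
Lemma CauchySchwarz u v : `|ip u v| <= `|u| * `|v|.
Proof.
have [->|v0] := eqVneq v 0; first by rewrite !ipE !normr0 mulr0.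
have nv : 0 < `|v| by rewrite normr_gt0.
rewrite -ler_sqr ?nnegrE ?mulr_ge0 // real_normK ?num_real // exprMn.
have := sqr_ge0 `|u - (ip u v / `|v| ^+ 2) *: v|.
rewrite normB_sqr normrZ exprMn real_normK ?num_real // ipZr.
have nv2 := lt0r_neq0 nv.
rewrite (_ : _ + _ = `|u| ^+ 2 - ip u v ^+ 2 / `|v| ^+ 2); last by field.
by rewrite subr_ge0 ler_pdivrMr // exprn_gt0.
Qed.

Lemma ip_le u v : ip u v <= `|u| * `|v|.
Proof. exact: le_trans (ler_norm _) (CauchySchwarz u v). Qed.

Lemma ip_eq u v : (forall z, ip u z = ip v z) -> u = v.
Proof.
move=> uv; apply/eqP; rewrite -subr_eq0 -normr_eq0 -sqrf_eq0 ip_norm.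
by rewrite ipDl ipNl uv subrr.
Qed.

(** For the filter [\oo] this is [weak_cvg]; a general filter lets ultrafilters play the role of
    subsequences. *)
Definition weak_lim (F : set_system nat) (s : nat -> H) (l : H) :=
  forall z, ip (s n) z @[n --> F] --> ip l z.

Section filter_limits.
Context {F : set_system nat} {FF : ProperFilter F}.

Lemma cvg_weak_lim (s : nat -> H) l : s n @[n --> F] --> l -> weak_lim F s l.
Proof.
move=> sl z; apply/cvgrPdist_le => e e0.
have /cvgrPdist_le/(_ (e / (`|z| + 1))) := sl.
have z0 : 0 < `|z| + 1 by rewrite ltr_wpDl.
rewrite divr_gt0 // => /(_ isT); apply: filterS => n.
rewrite ler_pdivlMr // -ipNl -ipDl => /(le_trans _); apply.
by rewrite (le_trans (CauchySchwarz _ _)) // ler_wpM2l // lerDl.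
Qed.

(** Split off [ip (s n) (t n - m)], which vanishes because [s] is bounded. *)
Lemma weak_strong_lim (s t : nat -> H) l m (C : R) :
  (forall n, `|s n| <= C) -> weak_lim F s l -> t n @[n --> F] --> m ->
  ip (s n) (t n) @[n --> F] --> ip l m.
Proof.
move=> sC sl tm.
have C0 : 0 <= C := le_trans (normr_ge0 _) (sC 0%N).
rewrite (_ : (fun n => ip (s n) (t n)) =
  (fun n => ip (s n) m + ip (s n) (t n - m))); last first.
  by apply/funext => n; rewrite !ipE; ring.
rewrite -[ip l m]addr0; apply: cvgD; first exact: sl.
apply/cvgrPdist_le => e e0; have /cvgrPdist_le/(_ (e / (C + 1))) := tm.
have C1 : 0 < C + 1 by rewrite ltr_wpDl.
rewrite divr_gt0 // => /(_ isT); apply: filterS => n.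
rewrite ler_pdivlMr // sub0r normrN distrC => /(le_trans _); apply.
rewrite (le_trans (CauchySchwarz _ _)) // mulrC ler_wpM2l //.
by rewrite (le_trans (sC n)) // lerDl.
Qed.

Lemma weak_limD (s t : nat -> H) l m :
  weak_lim F s l -> weak_lim F t m -> weak_lim F (fun n => s n + t n) (l + m).
Proof.
move=> sl tm z; under eq_fun do rewrite ipDl.
by rewrite ipDl; apply: cvgD; [exact: sl | exact: tm].
Qed.

Lemma weak_limN (s : nat -> H) l :
  weak_lim F s l -> weak_lim F (fun n => - s n) (- l).
Proof.
move=> sl z; under eq_fun do rewrite ipNl.
by rewrite ipNl; apply: cvgN; exact: sl.
Qed.

Lemma weak_limB (s t : nat -> H) l m :
  weak_lim F s l -> weak_lim F t m -> weak_lim F (fun n => s n - t n) (l - m).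
Proof. by move=> sl /weak_limN; exact: weak_limD. Qed.

End filter_limits.

(* Minimizes u |-> <Uu,u> - 2 l(u): minimizing sequences are Cauchy by the
   parallelogram identity.  [U = id] is the Riesz representation theorem. *)
Lemma coercive_representation (U : {linear H -> H}) (alpha C : R) (l : H -> R) :
  0 < alpha -> bounded_linear U -> self_adjoint ip U ->
  (forall u, alpha * `|u| ^+ 2 <= ip (U u) u) ->
  (forall (k : R) u v, l (k *: u + v) = k * l u + l v) ->
  (forall u, `|l u| <= C * `|u|) ->
  exists v, forall u, ip (U v) u = l u.
Proof.
move=> alpha0 [M UM] Usa Ucoer llin lC.
pose J u := ip (U u) u - 2 * l u.
(* [J] is exactly quadratic along each line: [k = 1] and [k = 1/2] give the Cauchy estimate, a
   general [k] the stationarity of the limit. *)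
have JD (k : R) u h : J (k *: h + u) =
    J u + k ^+ 2 * ip (U h) h + 2 * k * (ip (U u) h - l h).
  have Ul : U (k *: h + u) = k *: U h + U u by exact: linearP.
  rewrite /J llin Ul !ipE (Usa h u) (ipC h (U u)).
  by ring.
have Jlb u : - (C ^+ 2 / alpha) <= J u.
  rewrite /J -subr_ge0 opprK.
  have h1 := Ucoer u; have h2 := le_trans (ler_norm _) (lC u).
  suff : 0 <= alpha * `|u| ^+ 2 - 2 * (C * `|u|) + C ^+ 2 / alpha by lra.
  rewrite (_ : _ + _ = (alpha * `|u| - C) ^+ 2 / alpha).
    by rewrite divr_ge0 ?sqr_ge0 // ltW.
  by have := lt0r_neq0 alpha0; move=> ?; field.
have Jinf : has_inf (range J).
  by split; [exists (J 0), 0 | exists (- (C ^+ 2 / alpha)) => _ [u _ <-]].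
pose m := inf (range J).
have mJ u : m <= J u by apply: ge_inf; [exact: Jinf.2 | exists u].
have /choice[u uP] : forall n : nat, exists u : H, J u <= m + n.+1%:R^-1.
  move=> n.
  have e0 : (0 : R) < n.+1%:R^-1 by rewrite invr_gt0.
  have [_ [v _ <-] /ltW Jv] := inf_adherent e0 Jinf.
  by exists v.
(* With [h = u i - u j], the value of [J] at the midpoint is the mean of the end values minus
   [ip (U h) h / 4], and it is still at least [m]. *)
have ucauchy i j : alpha / 2 * `|u i - u j| ^+ 2 <= i.+1%:R^-1 + j.+1%:R^-1.
  have := mJ ((2^-1) *: (u i - u j) + u j).
  have hi := uP i; have hj := uP j.
  have hU := Ucoer (u i - u j).
  have : J (1 *: (u i - u j) + u j) = J (u i) by rewrite scale1r subrK.
  rewrite !JD; move: hi hj; move: (i.+1%:R^-1) (j.+1%:R^-1) => ei ej.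
  by move=> hi hj h1 h2; lra.
have ucvg : cvgn u.
  apply: cauchy_cvgn => e e0.
  have d0 : 0 < alpha / 4 * e ^+ 2 by rewrite mulr_gt0 ?divr_gt0 ?exprn_gt0.
  have [N _ NP] : \forall n \near \oo, n.+1%:R^-1 < alpha / 4 * e ^+ 2.
    exact: (near_infty_natSinv_lt (PosNum d0)).
  exists N => n Nn; rewrite -ltr_sqr ?nnegrE ?(ltW e0) //.
  rewrite -(@ltr_pM2l _ (alpha / 2)) ?divr_gt0 //.
  apply: le_lt_trans (ucauchy _ _) _.
  have := NP _ (leqnn N); have := NP _ Nn => /=.
  by move: (n.+1%:R^-1) (N.+1%:R^-1) => e1 e2 h1 h2; lra.
have /cvg_ex[v uv] := ucvg.
exists v => h; set c := ip (U h) h; set e := ip (U v) h - l h.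
have c0 : 0 <= c by apply: le_trans (Ucoer h); rewrite mulr_ge0 ?sqr_ge0 ?ltW.
(* Moving from [u n] along [h] lowers [J] by at most [n.+1%:R^-1]; let [n] tend to infinity. *)
have key (k : R) : 0 <= k ^+ 2 * c + 2 * k * e.
  have step n : 0 <= k ^+ 2 * c + 2 * k * (ip (u n) (U h) - l h) + n.+1%:R^-1.
    have := mJ (k *: h + u n); have := uP n; rewrite JD -/c (Usa (u n)).
    by move: (n.+1%:R^-1) => e' h1 h2; lra.
  have lim : (k ^+ 2 * c + 2 * k * (ip (u n) (U h) - l h) + n.+1%:R^-1)
      @[n --> \oo] --> k ^+ 2 * c + 2 * k * e + 0.
    apply: cvgD; last exact: cvg_harmonic.
    apply: cvgD; first exact: cvg_cst.
    apply: cvgM; first exact: cvg_cst.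
    rewrite /e Usa; apply: cvgB; last exact: cvg_cst.
    exact: cvg_weak_lim.
  rewrite -[leRHS]addr0 -(cvg_lim _ lim) //.
  by apply: limr_ge; [apply/cvg_ex; eexists; exact: lim | exact: nearW].
apply/eqP; rewrite -subr_eq0 -/e -sqrf_eq0 eq_le sqr_ge0 andbT.
have c1 : 0 < c + 1 by rewrite ltr_wpDl.
(* Dividing by [c + 1] instead of the optimal [c] avoids the case [c = 0]; the value is still a
   negative multiple of [e ^+ 2]. *)
have := key (- e / (c + 1)).
rewrite (_ : _ + _ = - (e ^+ 2 * ((c + 2) / (c + 1) ^+ 2))); last first.
  by have := lt0r_neq0 c1; move=> ?; field.
rewrite oppr_ge0 pmulr_lle0 // divr_gt0 ?exprn_gt0 //.
by rewrite ltr_wpDl.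
Qed.

(** The limits of [ip (s n) z] along [F] form a bounded linear functional of [z], whose Riesz
    representative is the weak limit. *)
Lemma ultra_weak_lim (F : set_system nat) (s : nat -> H) (C : R) :
  UltraFilter F -> (forall n, `|s n| <= C) -> exists l, weak_lim F s l.
Proof.
move=> FU sC.
have C0 : 0 <= C := le_trans (normr_ge0 _) (sC 0%N).
have bnd z n : `|ip (s n) z| <= C * `|z|.
  by rewrite (le_trans (CauchySchwarz _ _)) // ler_wpM2r.
have /choice[l lP] : forall z : H, exists r : R, ip (s n) z @[n --> F] --> r.
  by move=> z; exact: ultra_bounded_cvg (bnd z).
have [|||||v vP] := @coercive_representation idfun 1 C l ltr01.
- by exists 1 => x; rewrite mul1r.
- by [].
- by move=> u; rewrite mul1r ip_norm.
- move=> k u v; have lim : ip (s n) (k *: u + v) @[n --> F] --> k * l u + l v.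
    under eq_fun do rewrite ipDr ipZr.
    by apply: cvgD; [apply: cvgM; [exact: cvg_cst|exact: lP]|exact: lP].
  exact: cvg_unique (lP _) lim.
- move=> u; have h : `|ip (s n) u| @[n --> F] --> `|l u|.
    by apply: cvg_norm; exact: lP.
  rewrite -(cvg_lim _ h) //; apply: limr_le.
    by apply/cvg_ex; eexists; exact: h.
  by apply: nearW => n; exact: bnd.
by exists v => z; rewrite -[ip v z]/(ip (idfun v) z) vP; exact: lP.
Qed.

End hilbert.

(** * Maximally monotone operators and weak limits in the sum [A + B] *)

Section monotone.
Context {R : realType} {H : completeNormedModType R} (ip : {dot H for idfun}).
Context (ip_norm : forall x : H, `|x| ^+ 2 = ip x x).
Implicit Types A : H -> set H.

(** Otherwise adding the pair [(x, u)] to the graph would give a proper monotone extension. *)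
Lemma maximally_monotone_mem A x u : maximally_monotone_op ip A ->
  (forall y v, A y v -> 0 <= ip (x - y) (u - v)) -> A x u.
Proof.
move=> [Amon Amax] xu; apply: contrapT => nAxu; apply: Amax.
exists (fun y => A y `|` [set v | y = x /\ v = u]); split.
  move=> y v y' v' [Ay|[/= -> ->]] [Ay'|[/= -> ->]].
  - exact: Amon Ay Ay'.
  - have := xu _ _ Ay; rewrite -(opprB y x) -(opprB v u) ipNl ipNr opprK.
    by [].
  - exact: xu.
  - by rewrite subrr ip0l.
split; first by move=> [y v] Ay; left.
by move=> /(_ (x, u)) /= Axu; apply: nAxu; apply: Axu; right.
Qed.

Lemma zer_addP A (B : H -> H) x :
  zer (op_add A (single_valued B)) x <-> A x (- B x).
Proof.
split=> [[u Axu [_ ->]] /eqP|Axu].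
  by rewrite addr_eq0 => /eqP <-.
by exists (- B x) => //; exists (B x) => //; rewrite addNr.
Qed.

Lemma lipschitz_norm (B : H -> H) (beta : R) x y :
  beta.-lipschitz B -> `|B x - B y| <= beta * `|x - y|.
Proof. by move=> /(_ (x, y)) /=; apply. Qed.

(* Evaluating monotonicity of B against the weak limit bounds
   l := lim <s n, B (s n)> below, and that of A, once the limit point has been
   shown to lie in its graph, bounds l above: equality identifies the weak
   limit of B (s n), without knowing that A + B is maximal. *)
Lemma demiclosed_sum A (B : H -> H) (beta C : R) (F : set_system nat)
    (s w : nat -> H) x :
  UltraFilter F -> maximally_monotone_op ip A ->
  0 < beta -> monotone_op ip (single_valued B) -> beta.-lipschitz B ->
  (forall n, `|s n| <= C) -> (forall n, A (s n) (w n)) ->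
  weak_lim ip F s x -> w n + B (s n) @[n --> F] --> (0 : H) ->
  A x (- B x).
Proof.
move=> FU Amax beta0 Bmon Blip sC Asw sx wB.
have C0 : 0 <= C := le_trans (normr_ge0 _) (sC 0%N).
have BC n : `|B (s n)| <= `|B 0| + beta * C.
  have := lipschitz_norm (s n) 0 Blip; rewrite subr0 => h.
  rewrite -(subrK (B 0) (B (s n))) (le_trans (ler_normD _ _)) //.
  by rewrite addrC lerD2l (le_trans h) // ler_pM2l.
have [b Bb] := ultra_weak_lim ip_norm FU BC.
have [l ll] : exists l : R, ip (s n) (B (s n)) @[n --> F] --> l.
  apply: (@ultra_bounded_cvg _ _ _ (C * (`|B 0| + beta * C))) => n.
  by rewrite (le_trans (CauchySchwarz ip_norm _ _)) // ler_pM.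
have sr z : ip z (s n) @[n --> F] --> ip z x.
  by under eq_fun do rewrite ipC; rewrite ipC; exact: sx.
have Br z : ip z (B (s n)) @[n --> F] --> ip z b.
  by under eq_fun do rewrite ipC; rewrite ipC; exact: Bb.
have limB y : ip (s n - y) (B (s n) - B y) @[n --> F] -->
    l - ip x (B y) - ip y b + ip y (B y).
  rewrite (_ : (fun n => _) = (fun n => ip (s n) (B (s n)) - ip (s n) (B y)
     - ip y (B (s n)) + ip y (B y))); last first.
    by apply/funext => n; rewrite !ipE; ring.
  apply: cvgD; last exact: cvg_cst.
  by apply: cvgB; last exact: Br; apply: cvgB; [exact: ll | exact: sx].
have limB_ge0 y : 0 <= l - ip x (B y) - ip y b + ip y (B y).
  rewrite -(cvg_lim _ (limB y)) //; apply: limr_ge.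
    by apply/cvg_ex; eexists; exact: limB.
  by apply: nearW => n; exact: Bmon.
have limA y v : ip (s n - y) (w n - v) @[n --> F] -->
    ip x 0 - l - ip x v - (ip y 0 - ip y b - ip y v).
  rewrite (_ : (fun n => _) = (fun n =>
      ip (s n) (w n + B (s n)) - ip (s n) (B (s n)) - ip (s n) v -
      (ip y (w n + B (s n)) - ip y (B (s n)) - ip y v))); last first.
    by apply/funext => n; rewrite !ipE; ring.
  apply: cvgB.
    apply: cvgB; last exact: sx.
    by apply: cvgB; last exact: ll; exact: weak_strong_lim wB.
  apply: cvgB; last exact: cvg_cst.
  apply: cvgB; last exact: Br.
  by under eq_fun do rewrite ipC; rewrite ipC; exact: cvg_weak_lim.
have limA_ge0 y v : A y v -> 0 <= - l - ip x v + ip y b + ip y v.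
  move=> Ayv.
  rewrite (_ : _ + _ = ip x 0 - l - ip x v - (ip y 0 - ip y b - ip y v)).
    rewrite -(cvg_lim _ (limA y v)) //; apply: limr_ge.
      by apply/cvg_ex; eexists; exact: limA.
    by apply: nearW => n; exact: Amax.1 (Asw n) Ayv.
  by rewrite !ip0r; ring.
(* Adding the inequality of [A] at [(y, v)] and that of [B] at [x] eliminates [l]. *)
have Axb : A x (- b).
  apply: maximally_monotone_mem Amax _ => y v /limA_ge0.
  have := limB_ge0 x.
  by rewrite !ipE; lra.
have lxb : l = ip x b.
  apply/eqP; rewrite eq_le; apply/andP; split.
    by have := limA_ge0 _ _ Axb; rewrite !ipE; lra.
  by have := limB_ge0 x; lra.
suff -> : B x = b by [].
(* Minty's argument: monotonicity of [B] is tested at [x + t *: k], where [t = 1 / (2 beta)] makes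
   the Lipschitz bound [|k| / 2], so that [|k|^2 <= |k|^2 / 2]. *)
pose k := b - B x; apply/esym/eqP; rewrite -subr_eq0 -/k -normr_eq0.
pose t := (2 * beta)^-1.
have t0 : 0 < t by rewrite invr_gt0 mulr_gt0.
have : `|k| ^+ 2 <= ip k (B (x + t *: k) - B x).
  have := limB_ge0 (x + t *: k); rewrite lxb ip_norm.
  rewrite (_ : _ + _ = - t * ip k (b - B (x + t *: k))); last first.
    by rewrite !ipE; ring.
  rewrite mulNr oppr_ge0 pmulr_rle0 // => h.
  by rewrite {2}/k; move: h; rewrite !ipE; lra.
move=> /le_trans/(_ (ip_le ip_norm _ _)) h.
have := lipschitz_norm (x + t *: k) x Blip.
rewrite addrAC subrr add0r normrZ (gtr0_norm t0) => h2.
have {h2} : `|B (x + t *: k) - B x| <= `|k| / 2.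
  by rewrite (le_trans h2) // /t le_eqVlt; apply/orP; left; apply/eqP; field;
     exact: lt0r_neq0.
move=> /(ler_wpM2l (normr_ge0 k)) h2.
rewrite -sqrf_eq0 eq_le sqr_ge0 andbT.
by have := le_trans h h2; rewrite expr2; lra.
Qed.

End monotone.

(** * Positive operators and their inverses *)

Section metrics.
Context {R : realType} {H : completeNormedModType R} (ip : {dot H for idfun}).
Context (ip_norm : forall x : H, `|x| ^+ 2 = ip x x).
Implicit Types U W : {linear H -> H}.

(** Evaluate the form of [D] at [x - M^-1 D x] and bound its quadratic term by the upper bound at
    [D x]. *)
Lemma positive_cocoercive (D : H -> H) (M : R) : 0 < M -> linear D ->
  self_adjoint ip D -> (forall x, 0 <= ip (D x) x) ->
  (forall x, ip (D x) x <= M * `|x| ^+ 2) ->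
  forall x, `|D x| ^+ 2 <= M * ip (D x) x.
Proof.
move=> M0 Dlin Dsa D0 DM x.
have := D0 (- M^-1 *: D x + x); rewrite Dlin !ipE.
rewrite -!ip_norm (Dsa (D x) x) -!ip_norm.
have := DM (D x).
move=> h1 h2.
have h3 : M^-1 * (M^-1 * ip (D (D x)) (D x)) <= M^-1 * `|D x| ^+ 2.
  by rewrite ler_pM2l ?invr_gt0 // ler_pdivrMl.
by rewrite -ler_pdivrMl //; lra.
Qed.

(** Coercivity makes [U] injective and, by representing the functionals [ip x], surjective. The last
    bound is the cocoercivity of [U] read at [W x]. *)
Lemma coercive_inverse U (alpha M : R) : 0 < alpha -> 0 < M ->
  self_adjoint ip U -> (forall x, alpha * `|x| ^+ 2 <= ip (U x) x) ->
  (forall x, `|U x| <= M * `|x|) ->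
  exists W, [/\ forall x, U (W x) = x, forall x, W (U x) = x,
    self_adjoint ip W, forall x, `|W x| <= alpha^-1 * `|x| &
    forall x, `|x| ^+ 2 <= M * ip (W x) x].
Proof.
move=> alpha0 M0 Usa Ucoer UM.
have Ulow x : alpha * `|x| <= `|U x|.
  have [->|x0] := eqVneq x 0; first by rewrite normr0 mulr0.
  rewrite -(@ler_pM2r _ `|x|) ?normr_gt0 //.
  by rewrite -mulrA -expr2 (le_trans (Ucoer x)) // ip_le.
have Uinj : injective U.
  move=> x y Uxy; apply/eqP; rewrite -subr_eq0 -normr_eq0 eq_le normr_ge0 andbT.
  by have := Ulow (x - y); rewrite linearB Uxy subrr normr0 pmulr_rle0.
have /choice[W UW] : forall x, exists y, U y = x.
  move=> x; have [|||||y yP] :=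
    @coercive_representation _ _ ip ip_norm U alpha `|x| (ip x) alpha0.
  - by exists M.
  - exact: Usa.
  - exact: Ucoer.
  - by move=> k u v; rewrite ipDr ipZr.
  - by move=> u; exact: CauchySchwarz.
  - by exists y; apply: (ip_eq ip_norm).
have Wlin : linear W.
  by move=> k u v; apply: Uinj; rewrite linearP !UW.
pose Wl : {linear H -> H} := HB.pack W (GRing.isLinear.Build R H H *:%R W Wlin).
exists Wl; split => //=.
- by move=> x; apply: Uinj; rewrite UW.
- by move=> x y; rewrite -{2}(UW x) Usa UW.
- move=> x; rewrite mulrC ler_pdivlMr // mulrC.
  by rewrite -{2}(UW x) Ulow.
- move=> x; rewrite -{1 3}(UW x) ipC.
  apply: positive_cocoercive => //.
  + by move=> k u v; rewrite linearP.
  + by move=> y; apply: le_trans (Ucoer y); rewrite mulr_ge0 ?sqr_ge0 ?ltW.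
  + move=> y; rewrite (le_trans (ip_le ip_norm _ _)) // expr2 mulrA.
    by rewrite ler_wpM2r.
Qed.

End metrics.

(** * Strong convergence of the metrics and Opial's argument in a variable metric *)

Section variable_metric.
Context {R : realType} {H : completeNormedModType R} (ip : {dot H for idfun}).
Context (ip_norm : forall x : H, `|x| ^+ 2 = ip x x).
Context (W : nat -> {linear H -> H}) (M : R).
Context (Wsa : forall n, self_adjoint ip (W n)).
Context (Wlow : forall n x, `|x| ^+ 2 <= M * ip (W n x) x).

(* After division by the growth factor the metrics decrease, and a decreasing
   sequence of positive operators converges strongly. *)
Lemma metric_cvg (K : R) (eta : nat -> R) : 0 < M -> 0 < K ->
  (forall n x, `|W n x| <= K * `|x|) ->
  (forall n, 0 <= eta n) -> summable_seq eta ->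
  (forall n x, ip (W n.+1 x) x <= (1 + eta n) * ip (W n x) x) ->
  forall z, cvgn (fun n => W n z).
Proof.
move=> M0 K0 WK eta0 seta Wdec z.
have W0 n x : 0 <= ip (W n x) x.
  by rewrite -(pmulr_rge0 _ M0) (le_trans _ (Wlow n x)) ?sqr_ge0.
pose g := growth eta.
have g1 n : 1 <= g n by exact: growth_ge1.
have g0 n : 0 < g n by exact: lt_le_trans ltr01 (g1 n).
pose V n (x : H) : H := (g n)^-1 *: W n x.
have V0 n x : 0 <= ip (V n x) x by rewrite ipZl mulr_ge0 // invr_ge0 ltW.
have VS n x : ip (V n.+1 x) x <= ip (V n x) x.
  rewrite !ipZl ler_pdivrMl // /g growthS -/(g n) (le_trans (Wdec n x)) //.
  rewrite le_eqVlt; apply/orP; left; apply/eqP.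
  by have := lt0r_neq0 (g0 n); move=> ?; field.
have Vdec n m x : (n <= m)%N -> ip (V m x) x <= ip (V n x) x.
  move=> /subnK <-; elim: (m - n)%N => // k IH.
  by rewrite addSn (le_trans (VS _ _)).
have VK n x : ip (V n x) x <= K * `|x| ^+ 2.
  rewrite (@le_trans _ _ (ip (W n x) x)) //.
    by rewrite ipZl ler_pdivrMl // ler_peMl.
  by rewrite (le_trans (ip_le ip_norm _ _)) // expr2 mulrA ler_wpM2r.
(* The operator [V n - V m] is positive and bounded by [K], so cocoercivity turns convergence of the
   numbers [ip (V n z) z] into the Cauchy property of the vectors [V n z]. *)
have Vdist n m : (n <= m)%N ->
    `|V n z - V m z| ^+ 2 <= K * (ip (V n z) z - ip (V m z) z).
  move=> nm; rewrite -ipNl -ipDl.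
  apply: (positive_cocoercive ip_norm K0 (D := fun x => V n x - V m x)).
  - move=> k u v; rewrite /V (linearP (W n)) (linearP (W m)) !scalerDr
      !scalerA !(mulrC _ k) -!scalerA.
    by rewrite scalerN opprD addrACA.
  - by move=> u v /=; rewrite !ipE !(Wsa _ u).
  - by move=> u; rewrite ipDl ipNl subr_ge0 Vdec.
  - by move=> u; rewrite ipDl ipNl (le_trans _ (VK n u)) // gerBl.
have qcvg : cvgn (fun n => ip (V n z) z).
  apply: nonincreasing_is_cvgn.
    by apply/nonincreasing_seqP => n; exact: VS.
  by exists 0 => _ [n _ <-].
have Vcvg : cvgn (V ^~ z).
  apply: cauchy_cvgn => e e0.
  have d0 : 0 < e ^+ 2 / K by rewrite divr_gt0 // exprn_gt0.
  have /cvgrPdist_lt/(_ _ d0)[N _ NP] := qcvg.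
  exists N => n Nn; rewrite -ltr_sqr ?nnegrE ?(ltW e0) //.
  apply: le_lt_trans (Vdist _ _ Nn) _.
  rewrite -ltr_pdivlMl // mulrC; have /= := NP _ (leqnn N).
  rewrite distrC; apply: le_lt_trans; apply: le_trans (ler_norm _).
  rewrite lerD2l lerN2; apply: (nonincreasing_cvgn_ge _ qcvg n).
  by apply/nonincreasing_seqP => k; exact: VS.
rewrite (_ : (fun n => W n z) = (fun n => g n *: V n z)); last first.
  by apply/funext => n; rewrite scalerA divff ?scale1r // lt0r_neq0.
by apply: is_cvgZ => //; exact: growth_cvg.
Qed.

Context (x : nat -> H) (C : R) (Z : set H).
Context (xC : forall n, `|x n| <= C).
Context (Wcvg : forall z, cvgn (fun n => W n z)).
Context (fejer : forall z, Z z -> cvgn (fun n => ip (W n (x n - z)) (x n - z))).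

(** Subtracting the Fejer quantities at [l] and [m] leaves the cross term [ip (x n) (W n (l - m))],
    which therefore converges. Its limits along [F] and [G] agree, so [l - m] is orthogonal to the
    limit of [W n (l - m)], and the uniform lower bound on [W n] forces [l = m]. *)
Lemma fejer_weak_cluster_unique (F G : set_system nat) (l m : H) :
  ProperFilter F -> ProperFilter G -> \oo `<=` F -> \oo `<=` G ->
  Z l -> Z m -> weak_lim ip F x l -> weak_lim ip G x m -> l = m.
Proof.
move=> FF GF ooF ooG Zl Zm xl xm.
have cvgFG (T : topologicalType) (u : nat -> T) (b : T) :
  u n @[n --> \oo] --> b -> u n @[n --> F] --> b /\ u n @[n --> G] --> b.
  by move=> ub; split=> A /ub; [exact: ooF | exact: ooG].
set z := l - m.
have /cvg_ex[/= w Ww] := @Wcvg z.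
have [WwF WwG] := cvgFG _ _ _ Ww.
have qcvg u : cvgn (fun n => ip (W n u) u).
  have /cvg_ex[/= wu Wu] := @Wcvg u.
  by apply/cvg_ex; exists (ip wu u); exact: cvg_weak_lim.
have acvg : cvgn (fun n => ip (x n) (W n z)).
  rewrite (_ : (fun n => _) = (fun n => 2^-1 * ((ip (W n l) l - ip (W n m) m) -
    (ip (W n (x n - l)) (x n - l) - ip (W n (x n - m)) (x n - m)))));
    last first.
    apply/funext => n; rewrite /z !linearB /= !ipE.
    rewrite (ipC _ (W n l) (x n)) (ipC _ (W n m) (x n)).
    by rewrite (Wsa n (x n) l) (Wsa n (x n) m); field.
  apply: is_cvgM; first exact: is_cvg_cst.
  by apply: is_cvgB; apply: is_cvgB => //; exact: fejer.
have /cvg_ex[/= a xWa] := acvg.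
have [aF aG] := cvgFG _ _ _ xWa.
have al : a = ip l w.
  by apply: cvg_unique aF _ => //; exact: weak_strong_lim xC xl WwF.
have am : a = ip m w.
  by apply: cvg_unique aG _ => //; exact: weak_strong_lim xC xm WwG.
apply/eqP; rewrite -subr_eq0 -/z -normr_eq0 -sqrf_eq0 eq_le sqr_ge0 andbT.
have lim : M * ip (W n z) z @[n --> \oo] --> M * ip w z.
  by apply: cvgM; [exact: cvg_cst | exact: cvg_weak_lim].
have wz : M * ip w z = 0 by rewrite ipC /z ipDl ipNl -al am subrr mulr0.
rewrite -wz -(cvg_lim _ lim) //; apply: limr_ge.
  by apply/cvg_ex; eexists; exact: lim.
by apply: nearW => n; exact: Wlow.
Qed.

(** If [x] did not converge to the cluster point [l], an ultrafilter on indices where [ip (x n) z]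
    stays away from [ip l z] would give a second cluster point, against uniqueness. *)
Lemma fejer_weak_cvg :
  (forall (F : set_system nat) l, UltraFilter F -> \oo `<=` F ->
     weak_lim ip F x l -> Z l) ->
  exists2 l, Z l & weak_lim ip \oo x l.
Proof.
move=> clusterZ.
have [F [FU ooF]] : exists F : set_system nat, UltraFilter F /\ \oo `<=` F.
  exact: ultraFilterLemma.
have [l xl] := ultra_weak_lim ip_norm FU xC.
have Zl := clusterZ _ _ FU ooF xl.
exists l => // z; apply/cvgrPdist_lt => e e0; apply: contrapT => nnear.
pose S := [set n | ~ `|ip l z - ip (x n) z| < e].
(* Failure of convergence means that [S] meets every tail. *)
have G0F : ProperFilter (within S \oo).
  apply: Build_ProperFilter => -[N _ NP]; apply: nnear.
  by exists N => // n /NP; rewrite /S /= => /contrapT.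
have [G [GU G0G]] := ultraFilterLemma G0F.
have ooG : \oo `<=` G.
  by move=> A ooA; apply: G0G; apply: filterS ooA.
have [m xm] := ultra_weak_lim ip_norm GU xC.
have Zm := clusterZ _ _ GU ooG xm.
have lm := fejer_weak_cluster_unique _ _ ooF ooG Zl Zm xl xm.
have GS : G S by apply: G0G; rewrite /within /=; exact: nearW.
have /cvgrPdist_lt/(_ _ e0) := xm z; rewrite -lm => Gnear.
by have [n []] := filter_ex (filterI GS Gnear).
Qed.

End variable_metric.

(** * The descent inequality for one iteration *)

Section tseng.
Context {R : realType} {H : completeNormedModType R} (ip : {dot H for idfun}).
Context (ip_norm : forall x : H, `|x| ^+ 2 = ip x x).

(** Inversion reverses the order: evaluate the form of [U] at [(1 + eta)^-1 W' x - W x] and compare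
    [U] with [U'] at [W' x]. *)
Lemma loewner_inverse (U U' W W' : {linear H -> H}) (eta : R) : 0 <= eta ->
  (forall x : H, U (W x) = x) -> (forall x : H, U' (W' x) = x) ->
  self_adjoint ip U -> (forall x : H, 0 <= ip (U x) x) ->
  (forall x : H, ip (U x) x <= (1 + eta) * ip (U' x) x) ->
  forall x : H, ip (W' x) x <= (1 + eta) * ip (W x) x.
Proof.
move=> eta0 UW UW' Usa U0 UU' x.
have e0 : 0 < 1 + eta by rewrite ltr_pwDl.
have := U0 ((1 + eta)^-1 *: W' x - W x).
rewrite opB opZ UW !ipE (Usa (W' x) (W x)) UW.
rewrite (ipC ip x (W' x)) (ipC ip x (W x)).
have := UU' (W' x); rewrite UW' (ipC ip x) => h1.
set u := ip (U _) _ in h1 *; set p := ip (W' x) x in h1 *.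
have h2 : (1 + eta)^-1 * ((1 + eta)^-1 * u) <= (1 + eta)^-1 * p.
  by rewrite ler_pM2l ?invr_gt0 // ler_pdivrMl.
rewrite -ler_pdivrMl //.
by lra.
Qed.

Section step.
Context (U W W' : {linear H -> H}) (B : H -> H).
Context (alpha beta M lambda gamma eta : R).
Context (M0 : 0 < M) (alpha0 : 0 < alpha) (beta0 : 0 < beta) (eta0 : 0 <= eta).
Context (WU : forall x : H, W (U x) = x).
Context (Wsa : self_adjoint ip W).
Context (UM : forall x : H, `|U x| <= M * `|x|).
Context (Wlow : forall x : H, `|x| ^+ 2 <= M * ip (W x) x).
Context (Wup : forall x : H, `|W x| <= alpha^-1 * `|x|).
Context (WW' : forall x : H, ip (W' x) x <= (1 + eta) * ip (W x) x).
Context (Blip : beta.-lipschitz B).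
Context (gamma0 : 0 < gamma) (gammal : gamma <= lambda).
Context (kappa : 10 * (lambda * M * beta) ^+ 2 <= 1).
Context (x x' s sm w g f z : H).
Context (mono : 0 <= ip (s - z) (w + B s)).
Context (x_s : x - s = gamma *: U (w + B sm + g)).
Context (x'E : x' = x - gamma *: U (w + B s) + f).

(** The squared norm in the metric [W]. Below, [xh] is the next iterate before the error [f], and
    [v] gathers the change of [B] between [sm] and [s] with the error [g]. *)
Let N v := ip (W v) v.
Let xh := x - gamma *: U (w + B s).
Let v := B sm - B s + g.

Let xhs : xh - s = gamma *: U v.
Proof.
rewrite /xh addrAC x_s -scalerBr -opB; congr (_ *: U _).
by rewrite -(addrA w) (addrC w) addrKA /v addrAC.
Qed.

Let NB a b : N (a - b) = N a - 2 * ip (W b) a + N b.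
Proof.
rewrite /N opB !ipE (ipC ip (W a) b) -(Wsa b a).
by ring.
Qed.

(** Expand [N (xh - z)] and [N (xh - s)] around [x]. In the difference the quadratic terms of the
    step cancel, and the linear ones combine into [2 gamma ip (w + B s) (s - z)], nonnegative by
    [mono]. *)
Let pythagoras : N (xh - z) <= N (x - z) - N (x - s) + N (xh - s).
Proof.
have h u : xh - u = (x - u) - gamma *: U (w + B s) by rewrite /xh addrAC.
rewrite (h z) (h s) !NB opZ WU.
have : 0 <= ip (gamma *: (w + B s)) (x - z) - ip (gamma *: (w + B s)) (x - s).
  rewrite -ipNr -ipDr opprB (addrC (x - z)) addrA subrK ipZl.
  rewrite mulr_ge0 ?(ltW gamma0) //.
  by rewrite ipC.
by lra.
Qed.

Let K := gamma ^+ 2 * M * `|v| ^+ 2.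

Let NxhsK : N (xh - s) <= K.
Proof.
rewrite xhs /N opZ WU ipZl ipZr mulrA -expr2 /K -mulrA ler_pM2l ?exprn_gt0 //.
by rewrite (le_trans (ip_le ip_norm _ _)) // expr2 mulrCA ler_wpM2l.
Qed.

(* Young's inequality with weight 1/8: since 2 * 9/8 * 1/10 = 9/40 < 1/4, twice
   K is absorbed by the terms |x - s|^2 / M and |x - sm|^2 / (2 M). *)
Let K_le : K <= 9 / 40 * (`|x - s| ^+ 2 / M + `|x - sm| ^+ 2 / M) +
  9 * (lambda ^+ 2 * M * `|g| ^+ 2).
Proof.
have v_le : `|v| ^+ 2 <= 9 / 8 * `|B sm - B s| ^+ 2 + 9 * `|g| ^+ 2.
  have : `|v| ^+ 2 <= (`|B sm - B s| + `|g|) ^+ 2.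
    by rewrite ler_sqr ?nnegrE ?addr_ge0 // ler_normD.
  have := sqr_ge0 (`|B sm - B s| / 4 - 2 * `|g|) => h1 h2.
  by apply: (le_trans h2); move: h1; lra.
have B_le : `|B sm - B s| ^+ 2 <= beta ^+ 2 * `|sm - s| ^+ 2.
  rewrite -exprMn ler_sqr ?nnegrE ?mulr_ge0 ?(ltW beta0) //.
  exact: lipschitz_norm.
have sms : `|sm - s| ^+ 2 <= 2 * (`|x - s| ^+ 2 + `|x - sm| ^+ 2).
  rewrite (_ : sm - s = (x - s) - (x - sm)); first exact: normB_sqr_le.
  by rewrite opprB (addrC (x - s)) addrA subrK.
have gl : gamma ^+ 2 <= lambda ^+ 2.
  by rewrite ler_sqr ?nnegrE ?(ltW gamma0) // (le_trans _ gammal) // ltW.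
set d := `|x - s| ^+ 2 in sms *; set r := `|x - sm| ^+ 2 in sms *.
have dr0 : 0 <= d + r by rewrite addr_ge0 ?sqr_ge0.
have lM : 0 <= lambda ^+ 2 * M by rewrite mulr_ge0 ?sqr_ge0 // ltW.
have : K <= lambda ^+ 2 * M * (9 / 4 * (beta ^+ 2 * (d + r)) + 9 * `|g| ^+ 2).
  rewrite /K; apply: (@le_trans _ _ (lambda ^+ 2 * M * `|v| ^+ 2)).
    by rewrite ler_wpM2r ?sqr_ge0 // ler_wpM2r // ltW.
  rewrite ler_wpM2l // (le_trans v_le) // lerD2r.
  have := ler_wpM2l (sqr_ge0 beta) sms; move: B_le.
  by move=> h1 h2; lra.
move=> /le_trans; apply; rewrite mulrDr lerD //; last by rewrite mulrCA.
have -> : lambda ^+ 2 * M * (9 / 4 * (beta ^+ 2 * (d + r))) =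
    9 / 40 * ((10 * (lambda * M * beta) ^+ 2) * ((d + r) / M)).
  by have := lt0r_neq0 M0; move=> ?; field.
rewrite -mulrDl ler_pM2l; last by lra.
by rewrite ler_piMl // divr_ge0 // ltW.
Qed.

(** [K] enters once through [pythagoras] and once through [|x' - s|^2 / (2 M)]. Hence
    [2 * 9/40 = 9/20], which leaves [1/2 - 9/20 = 1/20] of the term in [x - sm] and more of that in
    [x - s], and [2 * 9 = 18] in front of the error [g]. *)
Lemma tseng_step :
  ip (W' (x' - z)) (x' - z) + `|x' - s| ^+ 2 / (2 * M) <=
  (1 + (eta + (1 + eta) * (M / alpha * `|f|))) *
   (ip (W (x - z)) (x - z) + `|x - sm| ^+ 2 / (2 * M)
    - (`|x - s| ^+ 2 + `|x - sm| ^+ 2) / (20 * M)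
    + (18 * (lambda ^+ 2 * M * `|g| ^+ 2) + alpha^-1 * (`|f| + `|f| ^+ 2)
       + M^-1 * `|f| ^+ 2)).
Proof.
have x'z : x' - z = (xh - z) + f by rewrite x'E -/xh addrAC.
have x's : x' - s = (xh - s) + f by rewrite x'E -/xh addrAC.
have Mi0 : 0 < M^-1 by rewrite invr_gt0.
have ai0 : 0 < alpha^-1 by rewrite invr_gt0.
have Wxs : M^-1 * `|x - s| ^+ 2 <= N (x - s) by rewrite ler_pdivrMl.
have xhsK : `|xh - s| ^+ 2 <= M * K.
  by rewrite (le_trans (Wlow _)) // ler_wpM2l // ltW.
have x'sK : M^-1 * `|x' - s| ^+ 2 <= 2 * K + 2 * (M^-1 * `|f| ^+ 2).
  rewrite x's ler_pdivrMl // (le_trans (normD_sqr_le ip_norm _ _)) //.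
  have : M * (M^-1 * `|f| ^+ 2) = `|f| ^+ 2 by rewrite mulVKf // lt0r_neq0.
  by move: xhsK; lra.
have Nf : N f <= alpha^-1 * `|f| ^+ 2.
  by rewrite (le_trans (ip_le ip_norm _ _)) // expr2 mulrA ler_wpM2r.
(* By [2 t <= 1 + t^2] the cross term splits into an error relative to [N (xh - z)] and an absolute
   one, both of order [|f|]. *)
have cross : 2 * ip (W f) (xh - z) <= alpha^-1 * `|f| * (1 + M * N (xh - z)).
  apply: (@le_trans _ _ (alpha^-1 * `|f| * (2 * `|xh - z|))).
    rewrite mulrCA ler_pM2l // (le_trans (ip_le ip_norm _ _)) //.
    by rewrite ler_wpM2r.
  rewrite ler_wpM2l ?mulr_ge0 ?(ltW ai0) //.
  have := sqr_ge0 (`|xh - z| - 1); have := Wlow (xh - z); rewrite -/(N _).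
  by lra.
have N'x'z : ip (W' (x' - z)) (x' - z) <=
    (1 + eta) * ((1 + M / alpha * `|f|) * N (xh - z)
                  + alpha^-1 * (`|f| + `|f| ^+ 2)).
  apply: (le_trans (WW' _)); rewrite ler_pM2l ?ltr_pwDl //.
  have -> : ip (W (x' - z)) (x' - z) = N (xh - z) + 2 * ip (W f) (xh - z) + N f.
    rewrite x'z; move: (xh - z) => e.
    by rewrite /N opD !ipE (ipC ip (W e) f) -(Wsa f e); ring.
  by move: cross Nf; lra.
have K0 : 0 <= K by rewrite mulr_ge0 ?sqr_ge0 // mulr_ge0 ?sqr_ge0 // ltW.
have c0 : 0 <= M / alpha * `|f| by rewrite mulr_ge0 // divr_ge0 // ltW.
have f0 : 0 <= `|f| by [].
have ff0 : 0 <= M^-1 * `|f| ^+ 2 by rewrite mulr_ge0 ?sqr_ge0 // ltW.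
have F0 : 0 <= alpha^-1 * (`|f| + `|f| ^+ 2).
  by rewrite mulr_ge0 ?(ltW ai0) // addr_ge0 ?sqr_ge0.
have pyth := pythagoras.
have Kle := K_le.
set c := M / alpha * `|f| in c0 N'x'z *.
set F := alpha^-1 * (_ + _) in F0 N'x'z *.
set ff := M^-1 * `|f| ^+ 2 in ff0 x'sK *.
have -> : `|x' - s| ^+ 2 / (2 * M) = M^-1 * `|x' - s| ^+ 2 / 2.
  by rewrite invfM (mulrC M^-1 (_ ^+ 2)) mulrA mulrAC.
have -> : `|x - sm| ^+ 2 / (2 * M) = `|x - sm| ^+ 2 / M / 2.
  by rewrite invfM mulrA mulrAC.
have -> : (`|x - s| ^+ 2 + `|x - sm| ^+ 2) / (20 * M) =
   (`|x - s| ^+ 2 / M + `|x - sm| ^+ 2 / M) / 20.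
  by rewrite invfM mulrA mulrAC mulrDl.
rewrite -/(N _) [M^-1 * `|x - s| ^+ 2]mulrC in Wxs *.
set d := `|x - s| ^+ 2 / M in Wxs Kle *.
set r := `|x - sm| ^+ 2 / M in Kle *.
set G := lambda ^+ 2 * M * _ in Kle *.
have -> : 1 + (eta + (1 + eta) * c) = (1 + eta) * (1 + c) by ring.
set T := ip (W' _) _ in N'x'z *.
have P1 : (1 + eta) <= (1 + eta) * (1 + c).
  by rewrite ler_peMr ?lerDl // ltW // ltr_pwDl.
(* Terms carrying a smaller factor are enlarged to carry the common one. *)
apply: (@le_trans _ _ ((1 + eta) * (1 + c) *
    (N (x - z) - N (x - s) + K + F + (K + ff)))).
  rewrite mulrDr; apply: lerD; last first.
    rewrite (@le_trans _ _ (K + ff)) //; first by move: x'sK; lra.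
    by rewrite ler_peMl ?addr_ge0 // (le_trans _ P1) // lerDl.
  apply: (le_trans N'x'z); rewrite [leRHS]mulrDr mulrDr lerD //.
    rewrite mulrA ler_wpM2l ?(le_trans _ pyth) //.
      by rewrite (le_trans _ P1) // addr_ge0.
    by rewrite (le_trans pyth) // lerD2l.
  by rewrite ler_wpM2r.
rewrite ler_wpM2l //; first by rewrite (le_trans _ P1) // addr_ge0.
have d0 : 0 <= d by rewrite divr_ge0 ?sqr_ge0 ?ltW.
by move: Wxs Kle; lra.
Qed.

End step.
End tseng.

(** * Convergence of the iteration with merged errors *)

Section convergence.
Context {R : realType} {H : completeNormedModType R} (ip : {dot H for idfun}).
Context (ip_norm : forall x : H, `|x| ^+ 2 = ip x x).

Lemma summable_sqr_cvg0 (u : nat -> H) :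
  summable_seq (fun n => `|u n| ^+ 2) -> u n @[n --> \oo] --> (0 : H).
Proof.
move=> /cvg_series_cvg_0 /cvgrPdist_lt u0; apply/cvgrPdist_lt => e e0.
have := u0 _ (exprn_gt0 2 e0); apply: filterS => n.
rewrite !sub0r !normrN ger0_norm ?sqr_ge0 // ltr_sqr ?nnegrE //.
exact: ltW.
Qed.

Lemma cvg_bounded_mul (k : nat -> R) (C : R) (u : nat -> H) :
  (\forall n \near \oo, `|k n| <= C) -> u n @[n --> \oo] --> (0 : H) ->
  k n *: u n @[n --> \oo] --> (0 : H).
Proof.
move=> kC /cvgrPdist_lt u0; apply/cvgrPdist_lt => e e0.
have C1 : 0 < `|C| + 1 by rewrite ltr_wpDl.
have := u0 _ (divr_gt0 e0 C1); apply: filterS2 kC => n kC.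
rewrite !sub0r !normrN normrZ ltr_pdivlMr // => h.
rewrite (le_lt_trans _ h) // mulrC ler_wpM2l // (le_trans kC) //.
by rewrite (le_trans (ler_norm C)) // lerDl.
Qed.

(** For each zero [z], [tseng_step] feeds [robbins_siegmund]; this gives the two summability claims
    and the Fejer property, and [demiclosed_sum] identifies the cluster points for
    [fejer_weak_cvg]. *)
Lemma tseng_past_cvg (A : H -> set H) (B : H -> H)
    (alpha beta M lambda delta : R) (eta gamma : nat -> R)
    (U : nat -> {linear H -> H}) (sm1 : H) (x s w g f : nat -> H) :
  maximally_monotone_op ip A -> monotone_op ip (single_valued B) ->
  beta.-lipschitz B -> 0 < alpha -> 0 < beta -> 0 < M -> 0 < delta ->
  zer (op_add A (single_valued B)) !=set0 -> ell1_plus eta ->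
  (forall n, P_ ip alpha (U n)) -> (forall n z, `|U n z| <= M * `|z|) ->
  (forall n, loewner_ge ip (fun z => (1 + eta n) *: U n.+1 z) (U n)) ->
  (forall n, 0 < gamma n <= lambda) -> 10 * (lambda * M * beta) ^+ 2 <= 1 ->
  (\forall n \near \oo, delta <= gamma n) ->
  abs_summable g -> abs_summable f ->
  (forall n, A (s n) (w n)) ->
  (forall n, x n - s n =
     gamma n *: U n (w n + B (prev_term sm1 s n) + g n)) ->
  (forall n, x n.+1 = x n - gamma n *: U n (w n + B (s n)) + f n) ->
  exists xbar, [/\ zer (op_add A (single_valued B)) xbar,
    summable_seq (fun n => `|x n - s n| ^+ 2),
    summable_seq (fun n => `|x n - prev_term sm1 s n| ^+ 2) &
    weak_lim ip \oo x xbar].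
Proof.
move=> Amax Bmon Blip alpha0 beta0 M0 delta0 zer0 [eta0 seta] UP UM Umono.
move=> gammaP kappa gammad sg sf Asw xs xS.
have Usa n : self_adjoint ip (U n) by case: (UP n).
have Ucoer n z : alpha * `|z| ^+ 2 <= ip (U n z) z.
  by case: (UP n) => _ _ /(_ z); rewrite ipZl -ip_norm.
have /choice[W WP] : forall n, exists W : {linear H -> H},
    [/\ forall z, U n (W z) = z, forall z, W (U n z) = z,
    self_adjoint ip W, forall z, `|W z| <= alpha^-1 * `|z| &
    forall z, `|z| ^+ 2 <= M * ip (W z) z].
  by move=> n; exact: (coercive_inverse ip_norm).
have UW n z : U n (W n z) = z by case: (WP n).
have WU n z : W n (U n z) = z by case: (WP n).
have Wsa n : self_adjoint ip (W n) by case: (WP n).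
have Wup n z : `|W n z| <= alpha^-1 * `|z| by case: (WP n).
have Wlow n z : `|z| ^+ 2 <= M * ip (W n z) z by case: (WP n).
have WS n z : ip (W n.+1 z) z <= (1 + eta n) * ip (W n z) z.
  apply: (loewner_inverse (eta0 n) (UW n) (UW n.+1) (Usa n)) => u.
    by rewrite (le_trans _ (Ucoer n u)) // mulr_ge0 ?sqr_ge0 // ltW.
  by have := Umono n u; rewrite ipZl.
have W0 n z : 0 <= ip (W n z) z.
  by rewrite -(pmulr_rge0 _ M0) (le_trans _ (Wlow n z)) ?sqr_ge0.
(* These names turn [tseng_step] into the recursion of [robbins_siegmund]; only [V] depends on the
   zero [z]. *)
pose sm n := prev_term sm1 s n.
pose chi n := eta n + (1 + eta n) * (M / alpha * `|f n|).
pose E n := 18 * (lambda ^+ 2 * M * `|g n| ^+ 2)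
  + alpha^-1 * (`|f n| + `|f n| ^+ 2) + M^-1 * `|f n| ^+ 2.
pose d n := (`|x n - s n| ^+ 2 + `|x n - sm n| ^+ 2) / (20 * M).
pose V z n := ip (W n (x n - z)) (x n - z) + `|x n - sm n| ^+ 2 / (2 * M).
have nf n : 0 <= `|f n| by [].
have chi0 n : 0 <= chi n.
  by rewrite addr_ge0 // mulr_ge0 ?addr_ge0 // mulr_ge0 // divr_ge0 // ltW.
have schi : summable_seq chi.
  apply: summableD => //; have [C C0 etaC] := summable_bounded seta.
  apply: (@summable_le _ _ (fun n => (1 + C) * (M / alpha * `|f n|))).
    move=> n; have h : 0 <= M / alpha * `|f n|.
      by rewrite mulr_ge0 // divr_ge0 // ltW.
    rewrite mulr_ge0 ?addr_ge0 //= ler_wpM2r // lerD2l.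
    by rewrite (le_trans _ (etaC n)) // ler_norm.
  by apply: summableZ; exact: summableZ.
have lM (h : H) : 0 <= lambda ^+ 2 * M * `|h| ^+ 2.
  by rewrite mulr_ge0 ?sqr_ge0 // mulr_ge0 ?sqr_ge0 // ltW.
have E0 n : 0 <= E n.
  apply: addr_ge0; last by rewrite mulr_ge0 ?sqr_ge0 // invr_ge0 ltW.
  apply: addr_ge0; first by rewrite mulr_ge0 // lM.
  by rewrite mulr_ge0 ?addr_ge0 ?sqr_ge0 // invr_ge0 ltW.
have sE : summable_seq E.
  have sf2 := summable_sqr nf sf.
  apply: summableD; last exact: summableZ.
  apply: summableD; last by apply: summableZ; exact: summableD.
  by apply: summableZ; apply: summableZ; apply: summable_sqr => // n.
have d0 n : 0 <= d n.
  by rewrite divr_ge0 ?addr_ge0 ?sqr_ge0 // mulr_ge0 // ltW.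
have V0 z n : 0 <= V z n.
  by rewrite addr_ge0 // divr_ge0 ?sqr_ge0 // mulr_ge0 // ltW.
have step z : A z (- B z) ->
    forall n, V z n.+1 <= (1 + chi n) * (V z n - d n + E n).
  move=> Az n; have /andP[gamma0 gammal] := gammaP n.
  apply: (tseng_step ip_norm M0 alpha0 beta0 (eta0 n) (WU n) (Wsa n) (UM n)
    (Wlow n) (Wup n) (WS n) Blip gamma0 gammal kappa _ (xs n) (xS n)).
  have := Amax.1 _ _ _ _ (Asw n) Az.
  have := Bmon _ _ _ _ (erefl (B (s n))) (erefl (B z)).
  by rewrite !ipE; lra.
have rs z : A z (- B z) -> cvgn (V z) /\ summable_seq d.
  move=> Az; apply: (robbins_siegmund (chi := chi) (E := E)) => //.
  exact: step.
have [z0 /zer_addP Az0] := zer0.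
have [Vz0 sd] := rs _ Az0.
have dE n : `|x n - s n| ^+ 2 + `|x n - sm n| ^+ 2 = 20 * M * d n.
  by rewrite /d mulrC divfK // mulf_neq0 // lt0r_neq0.
have sxs : summable_seq (fun n => `|x n - s n| ^+ 2).
  apply: (@summable_le _ _ (fun n => 20 * M * d n)); last exact: summableZ.
  by move=> n; rewrite sqr_ge0 -dE lerDl sqr_ge0.
have sxsm : summable_seq (fun n => `|x n - sm n| ^+ 2).
  apply: (@summable_le _ _ (fun n => 20 * M * d n)); last exact: summableZ.
  by move=> n; rewrite sqr_ge0 -dE lerDr sqr_ge0.
have xs0 := summable_sqr_cvg0 sxs.
have [C C0 xC] : exists2 C, 0 < C & forall n, `|x n| <= C.
  have [D D0 VD] := cvgn_bounded Vz0.
  exists (1 + M * D + `|z0|) => [|n].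
    by rewrite ltr_wpDr // ltr_wpDr // mulr_ge0 // ltW.
  rewrite -(subrK z0 (x n)) (le_trans (ler_normD _ _)) // lerD2r.
  have h1 : `|x n - z0| ^+ 2 <= M * D.
    rewrite (le_trans (Wlow n _)) // ler_wpM2l ?(ltW M0) //.
    rewrite (le_trans _ (VD n)) // (le_trans _ (ler_norm _)) // lerDl.
    by rewrite divr_ge0 ?sqr_ge0 // mulr_ge0 // ltW.
  (* With the next line, this gives [t <= 1 + t^2] for [t = |x n - z0|]. *)
  have := sqr_ge0 (`|x n - z0| - 1).
  have : 0 <= `|x n - z0| ^+ 2 by exact: sqr_ge0.
  by move: h1; lra.
have [C' C'0 sC] : exists2 C, 0 < C & forall n, `|s n| <= C.
  have [D D0 xsD] : exists2 D, 0 < D & forall n, `|x n - s n| <= D.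
    by apply: cvgn_bounded; apply/cvg_ex; exists 0.
  exists (C + D) => [|n]; first exact: addr_gt0.
  rewrite -(subKr (x n) (s n)) (le_trans (ler_normB _ _)) //.
  exact: lerD.
have f0 : f n @[n --> \oo] --> (0 : H).
  by apply: summable_sqr_cvg0; apply: summable_sqr => // n.
have wB0 : w n + B (s n) @[n --> \oo] --> (0 : H).
  (* [e n] recovers [gamma n *: U n (w n + B (s n))] from null sequences: [sm n.+1] is [s n], so
     [x n.+1 - s n] is a shifted term of [x n - sm n]. Undoing [gamma n] and [U n] costs at most the
     factors [delta^-1] (eventually) and [alpha^-1]. *)
  pose e n := (x n - s n) - (x n.+1 - s n) + f n.
  have e0 : e n @[n --> \oo] --> (0 : H).
    suff : e n @[n --> \oo] --> (0 - 0 + 0 : H) by rewrite subr0 addr0.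
    apply: cvgD => //; apply: cvgB => //.
    exact: summable_sqr_cvg0 (summable_shift sxsm).
  have eE n : e n = gamma n *: U n (w n + B (s n)).
    rewrite /e opprB addrA subrK xS opprD opprB addrA subrK.
    by rewrite addrC subrK.
  have wBE n : w n + B (s n) = (gamma n)^-1 *: W n (e n).
    have /andP[/lt0r_neq0 g0 _] := gammaP n.
    by rewrite eE opZ WU scalerA mulVf // scale1r.
  under eq_fun do rewrite wBE.
  apply: (@cvg_bounded_mul _ delta^-1).
    apply: filterS gammad => n dg; have /andP[g0 _] := gammaP n.
    by rewrite gtr0_norm ?invr_gt0 // lef_pV2.
  apply/cvgrPdist_lt => k k0; move/cvgrPdist_lt/(_ (alpha * k)): e0.
  rewrite mulr_gt0 // => /(_ isT); apply: filterS => n.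
  rewrite !sub0r !normrN => h; apply: (le_lt_trans (Wup _ _)).
  by rewrite ltr_pdivrMl.
have [xbar /zer_addP zx xw] : exists2 l, zer (op_add A (single_valued B)) l &
    weak_lim ip \oo x l.
  apply: (fejer_weak_cvg ip_norm Wsa Wlow xC).
  - move=> z; have Ki0 : 0 < alpha^-1 by rewrite invr_gt0.
    exact: (metric_cvg ip_norm Wsa Wlow M0 Ki0 Wup eta0 seta WS).
  - move=> z /zer_addP /rs[Vz _].
    (* The second term of [V] tends to zero, so the metric term alone converges. *)
    rewrite (_ : (fun n => _) =
      (fun n => V z n - `|x n - sm n| ^+ 2 / (2 * M))).
      apply: is_cvgB => //; apply: is_cvgM; last exact: is_cvg_cst.
      by apply/cvg_ex; exists 0; exact: cvg_series_cvg_0.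
    by apply/funext => n; rewrite /V addrK.
  - move=> F l FU ooF xl; apply/zer_addP.
    have toF (u : nat -> H) (b : H) :
        u n @[n --> \oo] --> b -> u n @[n --> F] --> b.
      by move=> ul P /ul; exact: ooF.
    apply: (demiclosed_sum ip_norm FU Amax beta0 Bmon Blip sC Asw)
      (toF _ _ wB0).
    rewrite -(subr0 l) (_ : s = fun n => x n - (x n - s n)).
      by apply: weak_limB => //; apply: cvg_weak_lim => //; exact: toF.
    by apply/funext => n; rewrite subKr.
by exists xbar; split => //; apply/zer_addP.
Qed.

End convergence.

(** * The hypotheses in usable form, and the theorem *)

Lemma op_norm_le (R : realType) (H : completeNormedModType R)
    (U : {linear H -> H}) (m : R) :
  (op_norm U <= m%:E)%E -> forall x, `|U x| <= m * `|x|.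
Proof.
move=> Um x; have [->|x0] := eqVneq x 0.
  by rewrite linear0 !normr0 mulr0.
have nx : 0 < `|x| by rewrite normr_gt0.
have : (`|U (`|x|^-1 *: x)|%:E <= m%:E)%E.
  apply: le_trans Um; apply: ereal_sup_ubound; exists (`|x|^-1 *: x) => //=.
  by rewrite normrZ gtr0_norm ?invr_gt0 // mulVf ?lt0r_neq0.
rewrite lee_fin linearZ /= normrZ gtr0_norm ?invr_gt0 //.
by rewrite ler_pdivrMl // mulrC.
Qed.

(** The tail infima tend to a positive limit, so one of them is positive; lying below a real number,
    it is finite. *)
Lemma limn_einf_gt0 (R : realType) (u : nat -> R) :
  (0 < limn_einf (fun n => (u n)%:E))%E ->
  exists2 d : R, 0 < d & \forall n \near \oo, d <= u n.
Proof.
rewrite limn_einf_lim => lim0.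
have [n n0] : exists n, (0 < einfs (fun n => (u n)%:E) n)%E.
  apply: contrapT => nex; move: lim0; apply/negP; rewrite -leNgt.
  apply: lime_le; first exact: is_cvg_einfs.
  by apply: nearW => n; rewrite leNgt; apply/negP => ?; apply: nex; exists n.
have un k : (n <= k)%N -> (einfs (fun n => (u n)%:E) n <= (u k)%:E)%E.
  by move=> nk; apply: ereal_inf_lbound; exists k.
case: (einfs _ n) n0 un => [d||] //.
- rewrite lte_fin => d0 un; exists d => //.
  by exists n => // k /un; rewrite lee_fin.
- by move=> _ /(_ n (leqnn n)).
Qed.

Lemma summable_prev (R : realType) (u0 : R) (u : nat -> R) :
  summable_seq u -> summable_seq (prev_term u0 u).
Proof.
move=> /cvg_ex[l ul]; apply/cvg_ex; exists (u0 + l); rewrite -cvg_shiftS.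
rewrite (_ : [sequence _]_n = (fun n => u0 + series u n)).
  by apply: cvgD => //; exact: cvg_cst.
by apply/funext => n; rewrite /series /= big_nat_recl.
Qed.

(* When mu = 0 the hypothesis does not bound lambda, but then every positive M
   dominates the operators. *)
Lemma step_bound (R : realType) (lambda mu beta : R) :
  0 < lambda -> 0 <= mu -> 0 < beta ->
  (lambda%:E < ((Num.sqrt 10 * mu * beta)%:E)^-1)%E ->
  exists M, [/\ 0 < M, mu <= M & 10 * (lambda * M * beta) ^+ 2 <= 1].
Proof.
move=> lambda0 mu0 beta0.
have [->|mun0] := eqVneq mu 0.
  (* This makes [lambda * M * beta] equal to 1/4, and 10/16 is at most 1. *)
  exists (4 * lambda * beta)^-1; split.
  - by rewrite invr_gt0 !mulr_gt0.
  - by rewrite invr_ge0 !mulr_ge0 // ltW.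
  - rewrite (_ : lambda * _ * _ = 4^-1); first by lra.
    by field; rewrite !lt0r_neq0.
have mup : 0 < mu by rewrite lt_neqAle eq_sym mun0.
have s0 : 0 < Num.sqrt 10 * mu * beta by rewrite !mulr_gt0 // sqrtr_gt0.
rewrite inver (negbTE (lt0r_neq0 s0)) lte_fin -div1r ltr_pdivlMr // => h.
exists mu; split => //.
set r := Num.sqrt 10 in s0 h.
have -> : 10 * (lambda * mu * beta) ^+ 2 = (lambda * (r * mu * beta)) ^+ 2.
  by rewrite -[10 in LHS](@sqr_sqrtr _ 10) // -/r; ring.
by rewrite expr_le1 ?(ltW h) // mulr_ge0 // ltW.
Qed.

(* The extended-real inverse satisfies 0^-1 = +oo, so the bound on lambda is
   void when mu = 0, which happens only in the trivial space.
   The resolvent of gamma_n U_n A is single-valued, so membership of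
   p_n - b_n in its value at y_n means p_n = J(y_n) + b_n. *)
Theorem theorem10 (R : realType) (H : completeNormedModType R)
  (ip : {dot H for idfun}) (ip_norm : forall x : H, `|x| ^+ 2 = ip x x)
  (A : H -> set H) (A_max : maximally_monotone_op ip A)
  (alpha beta : R) (alpha_gt0 : 0 < alpha) (beta_gt0 : 0 < beta)
  (B : H -> H) (B_mono : monotone_op ip (single_valued B))
  (B_lip : beta.-lipschitz B)
  (zer_neq0 : zer (op_add A (single_valued B)) !=set0)
  (eta : nat -> R) (eta_l1 : ell1_plus eta)
  (U : nat -> {linear H -> H}) (U_P : forall n, P_ ip alpha (U n))
  (mu : R) (mu_sup : ereal_sup [set op_norm (U n) | n in [set: nat]] = mu%:E)
  (U_mono : forall n,
    loewner_ge ip (fun x => (1 + eta n) *: U n.+1 x) (U n))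
  (lambda : R)
  (lambda_lt : (lambda%:E < ((Num.sqrt 10 * mu * beta)%:E)^-1)%E)
  (gamma : nat -> R) (gamma_bnd : forall n, 0 < gamma n <= lambda)
  (gamma_liminf : (0 < limn_einf (fun n => (gamma n)%:E))%E)
  (a b c : nat -> H)
  (a_sum : abs_summable a) (b_sum : abs_summable b) (c_sum : abs_summable c)
  (x0 pm1 : H) (x y p q : nat -> H)
  (x_init : x 0%N = x0)
  (y_def : forall n, y n = x n - gamma n *: U n (B (prev_term pm1 p n) + a n))
  (p_def : forall n,
    resolvent (op_image (fun u => gamma n *: U n u) A) (y n) (p n - b n))
  (q_def : forall n, q n = p n - gamma n *: U n (B (p n) + c n))
  (x_next : forall n, x n.+1 = x n - y n + q n) :
  exists xbar : H, zer (op_add A (single_valued B)) xbar /\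
    (summable_seq (fun n => `|x n - p n| ^+ 2) /\
     summable_seq (fun n => `|y n - q n| ^+ 2)) /\
    (weak_cvg ip x xbar /\ weak_cvg ip p xbar).
have /andP[gamma0 /(lt_le_trans gamma0) lambda0] := gamma_bnd 0%N.
have Umu n z : `|U n z| <= mu * `|z|.
  apply: op_norm_le; rewrite -mu_sup; apply: ereal_sup_ubound.
  by exists n.
have mu0 : 0 <= mu.
  rewrite -lee_fin -mu_sup; apply: (@le_trans _ _ (op_norm (U 0%N))).
    by apply: ereal_sup_ubound; exists 0; rewrite /= ?linear0 normr0.
  by apply: ereal_sup_ubound; exists 0%N.
have [M [M0 muM kappa]] := step_bound lambda0 mu0 beta_gt0 lambda_lt.
have UM n z : `|U n z| <= M * `|z|.
  by rewrite (le_trans (Umu n z)) // ler_wpM2r.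
have [delta delta0 gammad] := limn_einf_gt0 gamma_liminf.
pose s n := p n - b n.
(* Unfolding the resolvent at [y n] produces the element [w n] of [A (s n)]. *)
have /choice[w wP] : forall n, exists w,
    A (s n) w /\ y n = s n + gamma n *: U n w.
  move=> n; have [_ [] -> [_ [w Aw <-] <-]] := p_def n.
  by exists w.
have Asw n : A (s n) (w n) by case: (wP n).
have ys n : y n = s n + gamma n *: U n (w n) by case: (wP n).
have pE n : p n = s n + b n by rewrite subrK.
(* [g] pays for replacing [p] by [s] inside [B] at the previous index, [f] for the same at the
   current index and for [b n] and [c n]. At index 0 both previous terms are [pm1], so [g 0] is just
   [a 0]. *)
pose g n := a n + (B (prev_term pm1 p n) - B (prev_term pm1 s n)).
pose f n := b n + gamma n *: U n (B (s n) - B (p n)) - gamma n *: U n (c n).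
have gl n : 0 <= gamma n <= lambda.
  by have /andP[/ltW -> ->] := gamma_bnd n.
have gU n z : `|gamma n *: U n z| <= lambda * M * `|z|.
  have /andP[g0 gle] := gl n.
  by rewrite normrZ ger0_norm // -mulrA ler_pM.
have lM0 : 0 <= lambda * M by rewrite mulr_ge0 // ltW.
have sf : abs_summable f.
  apply: (@summable_le _ _ (fun n => `|b n| + lambda * M * (beta * `|b n|)
                                      + lambda * M * `|c n|)).
    move=> n; rewrite normr_ge0 /= (le_trans (ler_normB _ _)) // lerD //.
    rewrite (le_trans (ler_normD _ _)) // lerD2l (le_trans (gU _ _)) //.
    rewrite ler_wpM2l ?lM0 // (le_trans (lipschitz_norm _ _ B_lip)) //.
    by rewrite /s addrC addKr normrN.
  apply: summableD; last exact: summableZ.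
  by apply: summableD => //; do 2 apply: summableZ.
have sg : abs_summable g.
  apply: (@summable_le _ _
    (fun n => `|a n| + beta * prev_term 0 (fun n => `|b n|) n)).
    move=> n; rewrite normr_ge0 /= (le_trans (ler_normD _ _)) // lerD2l.
    rewrite (le_trans (lipschitz_norm _ _ B_lip)) //.
    rewrite ler_wpM2l ?(ltW beta_gt0) //.
    case: n => [|n] /=; first by rewrite subrr normr0.
    by rewrite /s subKr.
  by apply: summableD => //; apply: summableZ; exact: summable_prev.
have xs n : x n - s n = gamma n *: U n (w n + B (prev_term pm1 s n) + g n).
  have -> : w n + B (prev_term pm1 s n) + g n =
      w n + (B (prev_term pm1 p n) + a n).
    by rewrite /g -addrA; congr (w n + _); rewrite addrCA subrKC addrC.
  rewrite opD scalerDr; have := ys n; rewrite y_def => /eqP.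
  by rewrite subr_eq => /eqP ->; rewrite -(addrA (s n)) addrAC subrr add0r.
have xS n : x n.+1 = x n - gamma n *: U n (w n + B (s n)) + f n.
  rewrite x_next ys q_def /f {1}pE !opB !opD.
  by apply: (ip_eq ip_norm) => z; rewrite !ipE; ring.
have [xbar [xbarZ sxs sxsm xw]] := tseng_past_cvg ip_norm A_max B_mono B_lip
  alpha_gt0 beta_gt0 M0 delta0 zer_neq0 eta_l1 U_P UM U_mono gamma_bnd kappa
  gammad sg sf Asw xs xS.
have nb n : 0 <= `|b n| by [].
have sb2 := summable_sqr nb b_sum.
exists xbar; split => //; split; split.
- apply: (@summable_le _ _ (fun n => 2 * (`|x n - s n| ^+ 2 + `|b n| ^+ 2))).
    move=> n; rewrite sqr_ge0 /= pE opprD addrA.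
    exact: (normB_sqr_le ip_norm).
  by apply: summableZ; exact: summableD.
- apply: (@summable_le _ _
    (fun n => 2 * (`|x n - s n| ^+ 2 + `|x n.+1 - s n| ^+ 2))).
    move=> n; rewrite sqr_ge0 /=.
    (* By the update rule [y n - q n] is [x n - x n.+1]; pass through [s n]. *)
    rewrite (_ : y n - q n = (x n - s n) - (x n.+1 - s n)).
      exact: (normB_sqr_le ip_norm).
    by rewrite x_next; apply: (ip_eq ip_norm) => z; rewrite !ipE; ring.
  by apply: summableZ; apply: summableD => //; exact: summable_shift sxsm.
- exact: xw.
(* [p] differs from [x] by two strongly null sequences. *)
- rewrite (_ : p = (fun n => x n - (x n - s n) + b n)); last first.
    by apply/funext => n; rewrite subKr.
  have b0 : b n @[n --> \oo] --> (0 : H) by exact: summable_sqr_cvg0.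
  have xs0 := summable_sqr_cvg0 sxs.
  suff : weak_lim ip \oo (fun n => x n - (x n - s n) + b n) (xbar - 0 + 0).
    by rewrite subr0 addr0.
  apply: weak_limD; last exact: cvg_weak_lim.
  by apply: weak_limB => //; exact: cvg_weak_lim.
Qed.
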